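(* Let $\Omega$ be an arbitrary set, let $H$ be a separable infinite-dimensional complex Hilbert space, and let $F(\Omega,B_{sk}(H))$ be the Lie algebra of all maps from $\Omega$ to $B_{sk}(H)$. Let $(\lambda_n)_{n\ge 1}$ be a sequence of nonzero complex numbers with $\sum_{n=1}^\infty\lambda_n\overline{\lambda_n}<\infty$ and such that $x_o=\sum_{n=1}^\infty\lambda_n s_{n,n+1}$ belongs to $F(\Omega,B_{sk}(H))$. Let $\mathcal{L}$ be a Lie subalgebra of $F(\Omega,B_{sk}(H))$ containing the element $x_o$ and the family $\{I\hat{e}_{i,i}\}_{i=1}^\infty\cup\{s_{i,j}\}_{i,j=1,\,i\neq j}^\infty$. Then every 2-local spatial derivation on $\mathcal{L}$ implemented by elements from $F(\Omega,B_{sk}(H))$ is a spatial derivation; that is, it has the form $x\mapsto[a,x]$, $x\in\mathcal{L}$, for some $a\in F(\Omega,B_{sk}(H))$.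
   Context: $B(H)$ is the algebra of all bounded linear operators on $H$, and $B_{sk}(H)=\{a\in B(H):a^*=-a\}$ with bracket $[a,b]=ab-ba$. The bracket on $F(\Omega,B_{sk}(H))$ is pointwise: $[a,b](t)=[a(t),b(t)]$. $\{e_i\}_{i=1}^\infty$ is a fixed maximal family of orthogonal minimal projections in $B(H)$ and $\{e_{i,j}\}_{i,j=1}^\infty$ is a corresponding system of matrix units ($e_{i,i}=e_i$, $e_{i,j}e_{j,i}=e_{i,i}$). $\hat{e}_{i,j}$ is the constant map $\Omega\to B(H)$ with value $e_{i,j}$; $s_{i,j}=\hat{e}_{i,j}-\hat{e}_{j,i}$ for $i\ne j$; $I$ is the imaginary unit of $\mathbb{C}$. Definitions. A map $\Delta$ on a Lie algebra $B$ (not assumed additive or linear) is a 2-local derivation if for all $x,y\in B$ there is a derivation $D_{x,y}$ of $B$ with $\Delta(x)=D_{x,y}(x)$, $\Delta(y)=D_{x,y}(y)$. Let $B$ be a Lie subalgebra of a Lie algebra $A$. A derivation $D$ on $B$ is spatial if it is implemented by an element of $A$, i.e. there is $a\in A$ with $D(x)=[a,x]$ for all $x\in B$. A 2-local derivation $\Delta:B\to B$ is a 2-local spatial derivation implemented by elements from $A$ if for all $x,y\in B$ there is $a\in A$ with $\Delta(x)=[a,x]$ and $\Delta(y)=[a,y]$. *)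

(* Defs.v *)
From HB Require Import structures.
From mathcomp Require Import all_boot all_order all_algebra.
From mathcomp Require Import all_classical all_reals all_analysis.
From mathcomp Require Import complex.

Set Implicit Arguments.
Unset Strict Implicit.
Unset Printing Implicit Defensive.

Import Order.TTheory GRing.Theory Num.Theory.
Import numFieldNormedType.Exports.

Local Open Scope classical_set_scope.
Local Open Scope ring_scope.

Section HilbertSpace.
Variables (R : realType) (H : completeNormedModType R[i]).

(* A complex Hilbert space is a complete normed space over R[i] together with
   an inner product, linear on the left and conjugate-linear on the right,
   that induces the norm. *)
Definition induces_norm (dot : {dot H for Num.conj}) : Prop :=
  forall v : H, dot v v = `|v| ^+ 2.

Definition separable_space : Prop := exists A : set H, countable A /\ dense A.

Definition infinite_dimensional : Prop :=
  forall (n : nat) (f : 'I_n -> H),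
    exists v : H, forall c : 'I_n -> R[i], v <> \sum_(k < n) c k *: f k.

End HilbertSpace.

Section Operators.
Variables (R : realType) (H : completeNormedModType R[i]).
Variable dot : {dot H for Num.conj}.

(* Operators are functions H -> H; addition and scalars are the pointwise ones
   of the library, and the product of B(H) is composition. *)
Definition BH : set (H -> H) :=
  [set a | linear a /\
           exists M : R, forall v : H, `|a v| <= (real_complex R M) * `|v|].

Definition is_adjoint (a b : H -> H) : Prop :=
  forall u v : H, dot (a u) v = dot u (b v).

Definition Bsk : set (H -> H) := [set a | BH a /\ is_adjoint a (- a)].

Definition projection (p : H -> H) : Prop :=
  [/\ BH p, p \o p = p & is_adjoint p p].

(* For projections, q <= p means p q = q. *)
Definition minimal_projection (p : H -> H) : Prop :=
  [/\ projection p, p <> 0 &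
      forall q, projection q -> p \o q = q -> q = 0 \/ q = p].

Definition orthogonal_minimal_projections (P : set (H -> H)) : Prop :=
  (forall p, P p -> minimal_projection p) /\
  (forall p q, P p -> P q -> p <> q -> p \o q = 0).

Definition maximal_orthogonal_family (e : nat -> H -> H) : Prop :=
  [/\ injective e, orthogonal_minimal_projections (range e) &
      forall P, orthogonal_minimal_projections P -> range e `<=` P ->
        P = range e].

Definition matrix_units (e : nat -> nat -> H -> H) : Prop :=
  [/\ forall i j, BH (e i j),
      forall i j, is_adjoint (e i j) (e j i) &
      forall i j k l, e i j \o e k l = if j == k then e i l else 0].

(* Convergence in the weak operator topology, the weakest of the usual readings
   of an infinite sum of operators.  When a n = c n *: (u n) with c square
   summable and u n = e n n.+1 - e n.+1 n, the series converges in norm, so that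
   all readings define the same sum. *)
Definition weak_sum (a : nat -> H -> H) (s : H -> H) : Prop :=
  forall u v : H,
    (series (fun n => dot (a n u) v : R[i]^o)) @ \oo --> (dot (s u) v : R[i]^o).

End Operators.

Section OperatorValuedMaps.
Variables (Omega : Type) (R : realType) (H : completeNormedModType R[i]).
Variable dot : {dot H for Num.conj}.

Local Notation maps := (Omega -> H -> H).

Local Notation C r := (real_complex R r).

Definition const_map (a : H -> H) : maps := fun _ => a.

Definition s_map (e : nat -> nat -> H -> H) (i j : nat) : maps :=
  const_map (e i j) - const_map (e j i).

Definition F_Bsk : set maps := [set x | forall t, Bsk dot (x t)].

Definition bracket (x y : maps) : maps :=
  fun t => (x t \o y t) - (y t \o x t).

(* B_sk(H), hence F(Omega, B_sk(H)), is a Lie algebra over the reals: it is not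
   stable under multiplication by the imaginary unit. *)
Definition lie_subalgebra (L : set maps) : Prop :=
  [/\ L `<=` F_Bsk,
      L 0,
      forall x y, L x -> L y -> L (x + y),
      forall (r : R) x, L x -> L (C r *: x) &
      forall x y, L x -> L y -> L (bracket x y)].

(* A map on a subset L of maps is represented by a total function of which only
   the restriction to L matters. *)
Definition derivation (L : set maps) (D : maps -> maps) : Prop :=
  [/\ forall x, L x -> L (D x),
      forall x y, L x -> L y -> D (x + y) = D x + D y,
      forall (r : R) x, L x -> D (C r *: x) = C r *: D x &
      forall x y, L x -> L y ->
        D (bracket x y) = bracket (D x) y + bracket x (D y)].

Definition spatial_derivation (A L : set maps) (D : maps -> maps) : Prop :=
  derivation L D /\
  exists a, A a /\ forall x, L x -> D x = bracket a x.

Definition two_local_derivation (L : set maps) (Delta : maps -> maps) : Prop :=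
  (forall x, L x -> L (Delta x)) /\
  forall x y, L x -> L y ->
    exists D, [/\ derivation L D, Delta x = D x & Delta y = D y].

Definition two_local_spatial_derivation
    (A L : set maps) (Delta : maps -> maps) : Prop :=
  two_local_derivation L Delta /\
  forall x y, L x -> L y ->
    exists a, [/\ A a, Delta x = bracket a x & Delta y = bracket a y].

End OperatorValuedMaps.

(* Main.v *)
Require Import Defs.
From HB Require Import structures.
From mathcomp Require Import all_boot all_order all_algebra.
From mathcomp Require Import all_classical all_reals all_analysis.
From mathcomp Require Import complex ring zify.

(** Fix a point of Omega and an orthonormal basis (f_k) adapted to the matrix
    units.  If an operator c of B_sk(H) commutes with the rank one operator
    i u u^*, then u is an eigenvector of c with an imaginary eigenvalue, so
    <[c, x] u, u> = 0 for every x.  Hence a 2-local map T killing i u u^* satisfies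
    <T(x) u, u> = 0 for all x, and by polarization T = 0 as soon as it kills
    i u u^* for all u = f_k + z f_l.

    For every n, subtracting from T an inner derivation which agrees with T on a
    diagonal matrix with n distinct nonzero weights and on i J J^*, where
    J = f_0 + ... + f_(n-1), shows that the n x n corner of T is that of [c, .]
    for some c = c_n.  Choose a with [a, .] equal to Delta at x_o and at
    i e_00, and let T = Delta - [a, .].  Then the corner of c_n commutes with e_00
    and, up to boundary terms, with the Jacobi matrix x_o, so c_n is scalar on the
    triangle i + j < n.  Letting n grow, T kills all the i u u^* above, whence
    Delta = [a, .]. *)

Set Implicit Arguments.
Unset Strict Implicit.
Unset Printing Implicit Defensive.

Import Order.TTheory GRing.Theory Num.Theory.
Import numFieldNormedType.Exports.

Local Open Scope classical_set_scope.
Local Open Scope ring_scope.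

(** * Inner product, skew-adjoint operators, eigenvectors and polarization *)

Section InnerProduct.
Variables (R : realType) (H : completeNormedModType R[i]).
Variable dot : {dot H for Num.conj}.

Lemma dotC (u v : H) : dot u v = (dot v u)^*.
Proof. by rewrite (hermC dot u v) /= expr0 mul1r. Qed.

Lemma dotDl (u v w : H) : dot (u + v) w = dot u w + dot v w.
Proof. exact: (linearDl dot w). Qed.

Lemma dotDr (u v w : H) : dot w (u + v) = dot w u + dot w v.
Proof. exact: (linearDr dot w). Qed.

Lemma dotBl (u v w : H) : dot (u - v) w = dot u w - dot v w.
Proof. exact: (linearBl dot w). Qed.

Lemma dotBr (u v w : H) : dot w (u - v) = dot w u - dot w v.
Proof. exact: (linearBr dot w). Qed.

Lemma dotNr (u w : H) : dot w (- u) = - dot w u.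
Proof. exact: (linearNr dot w). Qed.

Lemma dot0l (w : H) : dot 0 w = 0.
Proof. exact: (linear0l dot w). Qed.

Lemma dot0r (w : H) : dot w 0 = 0.
Proof. exact: (linear0r dot w). Qed.

Lemma dotZl c (u v : H) : dot (c *: u) v = c * dot u v.
Proof. exact: (linearZl_LR dot v). Qed.

Lemma dotZr c (u v : H) : dot u (c *: v) = c^* * dot u v.
Proof. exact: (linearZr_LR dot u). Qed.

Lemma dot_suml n (F : 'I_n -> H) (w : H) :
  dot (\sum_(k < n) F k) w = \sum_(k < n) dot (F k) w.
Proof. exact: (linear_sumlz dot w). Qed.

Lemma dotv_eq0 (v : H) : dot v v = 0 -> v = 0.
Proof. by move/eqP; rewrite dnorm_eq0 => /eqP. Qed.

Lemma dotP (u v : H) : (forall w, dot u w = dot v w) -> u = v.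
Proof.
move=> uv; apply/eqP; rewrite -subr_eq0; apply/eqP/dotv_eq0.
by rewrite dotBl uv subrr.
Qed.

Lemma conj_Ci : ('i%C : R[i])^* = - 'i%C.
Proof. by rewrite complexiE conjCi. Qed.

Lemma Ci_neq0 : ('i%C : R[i]) != 0.
Proof. by rewrite complexiE neq0Ci. Qed.

Lemma linear_opD (a : H -> H) : linear a -> forall u v, a (u + v) = a u + a v.
Proof. by move=> la u v; have := la 1 u v; rewrite !scale1r. Qed.

Lemma linear_op0 (a : H -> H) : linear a -> a 0 = 0.
Proof.
move=> la; have := la (-1) 0 0; rewrite scaler0 addr0 scaleN1r.
by move=> {1}->; rewrite addNr.
Qed.

Lemma linear_opZ (a : H -> H) : linear a -> forall c u, a (c *: u) = c *: a u.
Proof. by move=> la c u; have := la c u 0; rewrite !addr0 linear_op0 // addr0. Qed.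

Lemma linear_opN (a : H -> H) : linear a -> forall u, a (- u) = - a u.
Proof. by move=> la u; rewrite -[- u]scaleN1r linear_opZ // scaleN1r. Qed.

Lemma linear_opB (a : H -> H) : linear a -> forall u v, a (u - v) = a u - a v.
Proof. by move=> la u v; rewrite linear_opD // linear_opN. Qed.

Lemma subfE (a b : H -> H) v : (a - b) v = a v - b v.
Proof. by []. Qed.

Definition comm (a b : H -> H) : H -> H := (a \o b) - (b \o a).

Lemma BskL (a : H -> H) : Bsk dot a -> linear a.
Proof. by case=> -[]. Qed.

Lemma Bsk_skew (a : H -> H) : Bsk dot a -> forall u v, dot (a u) v = - dot u (a v).
Proof. by case=> _ ha u v; rewrite ha -dotNr. Qed.

Lemma Bsk_comm (a b : H -> H) : Bsk dot a -> Bsk dot b -> Bsk dot (comm a b).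
Proof.
move=> Ba Bb; have [[la [Ma hMa]] _] := Ba; have [[lb [Mb hMb]] _] := Bb.
split; first split.
- move=> c u v; rewrite /comm !fctE /= la lb la lb scalerBr.
  by rewrite opprD addrACA.
- exists (`|Ma| * `|Mb| + `|Mb| * `|Ma|) => v.
  have bnd (f g : H -> H) (Mf Mg : R) :
      (forall v, `|f v| <= (real_complex R Mf) * `|v|) ->
      (forall v, `|g v| <= (real_complex R Mg) * `|v|) ->
      `|f (g v)| <= real_complex R (`|Mf| * `|Mg|) * `|v|.
    move=> hf hg; apply: (le_trans (hf _)).
    have leC (M : R) : real_complex R M <= real_complex R `|M|.
      by rewrite lecR ler_norm.
    rewrite rmorphM -mulrA.
    apply: (@le_trans _ _ (real_complex R `|Mf| * `|g v|)).
      by apply: ler_wpM2r.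
    apply: ler_wpM2l; first by rewrite ler0c.
    by apply: (le_trans (hg v)); apply: ler_wpM2r.
  rewrite /comm !fctE /= rmorphD mulrDl.
  apply: (le_trans (ler_normB _ _)); apply: lerD.
    exact: (bnd a b Ma Mb).
  exact: (bnd b a Mb Ma).
- move=> u v; rewrite /comm !fctE /= dotNr dotBl dotBr.
  rewrite (Bsk_skew Ba) (Bsk_skew Bb) (Bsk_skew Bb) (Bsk_skew Ba).
  by rewrite !opprK opprB.
Qed.

Lemma Bsk_sub (a b : H -> H) : Bsk dot a -> Bsk dot b -> Bsk dot (a - b).
Proof.
move=> Ba Bb; have [[la [Ma hMa]] _] := Ba; have [[lb [Mb hMb]] _] := Bb.
split; first split.
- by move=> c u v; rewrite !fctE la lb scalerBr opprD addrACA.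
- exists (Ma + Mb) => v; rewrite !fctE rmorphD mulrDl.
  by apply: (le_trans (ler_normB _ _)); apply: lerD.
- move=> u v; rewrite !fctE dotNr dotBl dotBr.
  by rewrite (Bsk_skew Ba) (Bsk_skew Bb) opprB opprK addrC.
Qed.

Lemma commE (a b : H -> H) v : comm a b v = a (b v) - b (a v).
Proof. by []. Qed.

Lemma comm_subl (a b x : H -> H) :
  linear x -> comm (a - b) x = comm a x - comm b x.
Proof.
move=> lx; apply/funext => v; rewrite subfE !commE !subfE linear_opB //.
by rewrite !opprB addrACA [RHS]addrACA [- b _ - _]addrC.
Qed.

Definition rank2 (u v : H) : H -> H :=
  fun w => 'i%C *: (dot w v *: u + dot w u *: v).

Lemma eigen_imaginary c u alpha :
  Bsk dot c -> c u = alpha *: u -> u = 0 \/ alpha^* = - alpha.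
Proof.
move=> Bc cu; have := Bsk_skew Bc u u; rewrite cu dotZl dotZr => /eqP.
rewrite -subr_eq0 opprK -mulrDl mulf_eq0 dnorm_eq0 => /orP[|/eqP->]; last by left.
by rewrite addrC addr_eq0 => /eqP; right.
Qed.

(** By skewness, [c, i u u^*] = i (alpha + conj alpha) u u^*, and alpha is imaginary unless u =
    0. *)
Lemma comm_rank2_eigen c u alpha :
  Bsk dot c -> c u = alpha *: u -> comm c (rank2 u u) = 0.
Proof.
move=> Bc cu; have lc := BskL Bc; apply/funext => w.
rewrite commE /rank2 linear_opZ // linear_opD // linear_opZ // cu.
rewrite (Bsk_skew Bc) cu dotZr.
by have [->|->] := eigen_imaginary Bc cu;
  rewrite ?scaler0 ?addr0 ?scaler0 ?subrr // mulNr opprK !scalerA mulrC subrr.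
Qed.

(** Evaluating the commutator at u itself gives <u,u> c u = <c u,u> u up to a nonzero scalar. *)
Lemma rank2_commutant c u :
  Bsk dot c -> comm c (rank2 u u) = 0 -> exists alpha, c u = alpha *: u.
Proof.
move=> Bc /(congr1 (fun g => g u)); have lc := BskL Bc.
have [->|u0] := eqVneq u 0; first by exists 0; rewrite linear_op0 // scaler0.
rewrite commE /rank2 linear_opZ // -scalerBr => /eqP.
rewrite scaler_eq0 (negPf Ci_neq0) /= linear_opD // linear_opZ // subr_eq0.
rewrite -!scalerDl => /eqP cu; have d0 : dot u u + dot u u != 0.
  by rewrite -mulr2n mulrn_eq0 /= dnorm_eq0.
exists ((dot u u + dot u u)^-1 * (dot (c u) u + dot (c u) u)).
by rewrite -scalerA -cu scalerK.
Qed.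

Lemma comm_eigen_form c x u alpha :
  Bsk dot c -> Bsk dot x -> c u = alpha *: u -> dot (comm c x u) u = 0.
Proof.
move=> Bc Bx cu; rewrite commE dotBl (Bsk_skew Bc) cu dotZr.
rewrite (linear_opZ (BskL Bx)) dotZl.
have [->|->] := eigen_imaginary Bc cu; first by rewrite !dot0r !mulr0 subr0 oppr0.
by rewrite mulNr opprK subrr.
Qed.

(** Only nonreal z is assumed, because [two_local_corner] controls the form only for such z and for
    z = 0. The values z = i and z = 1 + i suffice: the first equates the two cross terms, and the
    second then gives twice their common value. *)
Lemma polarization (X : H -> H) u v :
  linear X -> dot (X u) u = 0 -> dot (X v) v = 0 ->
  (forall z : R[i], z^* != z -> dot (X (u + z *: v)) (u + z *: v) = 0) ->
  dot (X v) u = 0.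
Proof.
move=> lX Xu Xv Xz.
have form z : z^* != z -> z * dot (X v) u + z^* * dot (X u) v = 0.
  move=> /Xz; rewrite linear_opD // linear_opZ // !dotDl !dotDr !dotZl !dotZr.
  by rewrite Xu Xv !mulr0 addr0 add0r addrC.
have i_neq : - 'i%C != 'i%C :> R[i].
  by rewrite eq_sym -subr_eq0 opprK -mulr2n mulrn_eq0 /= Ci_neq0.
have := form 'i%C; rewrite conj_Ci => /(_ i_neq) eq1.
have := form (1 + 'i%C); rewrite rmorphD rmorph1 /= conj_Ci.
rewrite (inj_eq (addrI _)) => /(_ i_neq) eq2.
have eq3 : dot (X v) u = dot (X u) v.
  apply/eqP; rewrite -subr_eq0 -(mulrI_eq0 _ (mulfI Ci_neq0)).
  by rewrite mulrBr -mulNr eq1.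
have : 2%:R * dot (X v) u = 0.
  rewrite -eq2 -eq3; ring.
by move/eqP; rewrite mulf_eq0 pnatr_eq0 /= => /eqP.
Qed.

End InnerProduct.

(** * Matrix coefficients in an orthonormal basis; commutants of diagonal and Jacobi matrices *)

Section OrthonormalBasis.
Variables (R : realType) (H : completeNormedModType R[i]).
Variable dot : {dot H for Num.conj}.
Variable f : nat -> H.
Hypothesis f_orthonormal : forall i j, dot (f i) (f j) = (i == j)%:R.
Hypothesis f_complete : forall v, (forall i, dot v (f i) = 0) -> v = 0.

Inductive fspan : H -> Prop :=
| fspan0 : fspan 0
| fspanD c k u : fspan u -> fspan (c *: f k + u).

Lemma fspan_add u v : fspan u -> fspan v -> fspan (u + v).
Proof.
by move=> su sv; elim: su => [|c k w _ IH]; rewrite ?add0r // -addrA; apply: fspanD.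
Qed.

Lemma fspanZ c k : fspan (c *: f k).
Proof. by rewrite -[_ *: _]addr0; do 2!constructor. Qed.

Lemma fspan_f k : fspan (f k).
Proof. by rewrite -[f k]scale1r; apply: fspanZ. Qed.

Lemma fspan_sum n : fspan (\sum_(k < n) f k).
Proof.
elim: n => [|n IH]; first by rewrite big_ord0; constructor.
by rewrite big_ord_recr; apply: fspan_add => //; apply: fspan_f.
Qed.

Lemma coord_inj u v : (forall i, dot u (f i) = dot v (f i)) -> u = v.
Proof.
move=> uv; apply/eqP; rewrite -subr_eq0; apply/eqP/f_complete => i.
by rewrite dotBl uv subrr.
Qed.

(** Skewness moves the operator onto a basis vector, <x v, f_i> = - <v, x f_i>, so no continuity
    argument is required to pass from the f_j to all v. *)
Lemma Bsk_coord_inj x y : Bsk dot x -> Bsk dot y ->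
  (forall i j, dot (x (f j)) (f i) = dot (y (f j)) (f i)) -> x = y.
Proof.
move=> Bx By xy; apply/funext => v; apply: coord_inj => i.
rewrite (Bsk_skew Bx) (Bsk_skew By); congr (- dot _ _).
by apply: coord_inj => j; apply: xy.
Qed.

Lemma coord_sum (n : nat) (F : nat -> R[i]) i :
  dot (\sum_(k < n) F k *: f k) (f i) = if (i < n)%N then F i else 0.
Proof.
rewrite dot_suml; case: ltnP => [lt_in|le_ni].
  rewrite (bigD1 (Ordinal lt_in)) //= dotZl f_orthonormal eqxx mulr1.
  rewrite big1 ?addr0 // => k ne_k; rewrite dotZl f_orthonormal.
  by rewrite (_ : (_ == _) = false) ?mulr0 //; apply: contraNF ne_k => /eqP ki;
    apply/eqP/val_inj.
rewrite big1 // => k _; rewrite dotZl f_orthonormal.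
by rewrite ltn_eqF ?mulr0 // (leq_trans (ltn_ord k)).
Qed.

(** The weights start at 1, not 0, so that they differ from each other and from the eigenvalue 0 on
    the f_k with k >= n. *)
Definition regular_diagonal (n : nat) : H -> H :=
  fun w => \sum_(k < n) ('i%C * k.+1%:R * dot w (f k)) *: f k.

Lemma regular_diagonalE n k :
  (k < n)%N -> regular_diagonal n (f k) = ('i%C * k.+1%:R) *: f k.
Proof.
move=> lt_kn; apply: coord_inj => i.
rewrite (coord_sum _ (fun i => 'i%C * i.+1%:R * dot (f k) (f i))).
rewrite dotZl f_orthonormal; have [<-|ne_ki] := eqVneq k i; first by rewrite lt_kn.
by rewrite !mulr0 if_same.
Qed.

Lemma regular_diagonal_commutant n c k :
  Bsk dot c -> comm c (regular_diagonal n) = 0 -> (k < n)%N ->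
  exists alpha, c (f k) = alpha *: f k.
Proof.
move=> Bc /(congr1 (fun g => g (f k))) + lt_kn.
rewrite commE regular_diagonalE // (linear_opZ (BskL Bc)) => /eqP.
rewrite subr_eq0 => /eqP eqc.
exists (dot (c (f k)) (f k)); apply: coord_inj => i.
rewrite dotZl f_orthonormal; have [<-|ne_ki] := eqVneq k i; first by rewrite mulr1.
rewrite mulr0; have /(congr1 (fun v => dot v (f i))) := eqc.
rewrite dotZl (coord_sum _ (fun i => 'i%C * i.+1%:R * dot (c (f k)) (f i))).
(* For i < n the weights of f_i and f_k differ; for i >= n the weight of f_i is 0 and that of f_k is
   not. Either way the coordinate vanishes. *)
case: ifP => _ /eqP.
  rewrite -subr_eq0 -mulrBl -mulrBr !mulf_eq0 (negPf (Ci_neq0 R)) /= subr_eq0.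
  by rewrite eqr_nat eqSS (negPf ne_ki) => /eqP.
by rewrite !mulf_eq0 (negPf (Ci_neq0 R)) pnatr_eq0 /= => /eqP.
Qed.

Definition tridiagonal (mu : nat -> R[i]) (x : H -> H) : Prop :=
  forall i j, dot (x (f j)) (f i) =
    if j == i.+1 then mu i else if i == j.+1 then - mu j else 0.

(** Column 0 of c is read off the commutator with i f_0 f_0^*. Entry (i, j+1) of [c, x] = 0 then
    expresses entry (i, j+2) of c through columns j and j+1, after division by mu_(j+1). It involves
    row i+1 of column j+1, so each new column loses one row; this produces the triangle. *)
Lemma tridiagonal_commutant n mu x c :
  Bsk dot x -> Bsk dot c -> (forall i, mu i != 0) -> tridiagonal mu x ->
  (forall i j, (i < n)%N -> (j < n)%N -> dot (comm c x (f j)) (f i) = 0) ->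
  (forall i j, (i < n)%N -> (j < n)%N ->
    dot (comm c (rank2 dot (f 0) (f 0)) (f j)) (f i) = 0) ->
  forall j i, (i + j < n)%N ->
    dot (c (f j)) (f i) = dot (c (f 0)) (f 0) * (i == j)%:R.
Proof.
move=> Bx Bc mu0 tri cx cf0; set c00 := dot (c (f 0)) (f 0).
have lc := BskL Bc.
(* The weights are real because x is skew-adjoint with opposite entries at (i, i+1) and (i+1, i). *)
have mu_real i : (mu i)^* = mu i.
  have := Bsk_skew Bx (f i) (f i.+1).
  rewrite [dot (f i) _]dotC !tri !eqxx [i == i.+2]ltn_eqF ?leqnSn //.
  by move/oppr_inj/esym.
have xf0 : x (f 0) = - mu 0 *: f 1.
  apply: (coord_inj) => i; rewrite tri dotZl f_orthonormal /=.
  by rewrite [1%N == i]eq_sym; case: eqP; rewrite ?mulr1 ?mulr0.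
have xfS j : x (f j.+1) = mu j *: f j - mu j.+1 *: f j.+2.
  apply: (coord_inj) => i; rewrite tri dotBl !dotZl !f_orthonormal.
  rewrite eqSS [i == _]eq_sym; case: (eqVneq j i) => [<-|ne_ji].
    by rewrite gtn_eqF // mulr1 mulr0 subr0.
  by rewrite mulr0 sub0r; case: eqP => _; rewrite ?mulr1 ?mulr0 ?oppr0.
have entry i j : dot (comm c x (f j)) (f i) =
    dot (c (x (f j))) (f i) + dot (c (f j)) (x (f i)).
  by rewrite commE dotBl [dot (x _) _](Bsk_skew Bx) opprK.
pose P j := forall i, (i + j < n)%N -> dot (c (f j)) (f i) = c00 * (i == j)%:R.
have P0 : P 0.
  move=> i; rewrite addn0 => lt_in; have [->|i0] := eqVneq i 0; first by rewrite mulr1.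
  have n0 : (0 < n)%N by lia.
  have := cf0 i 0 lt_in n0; rewrite commE /rank2 f_orthonormal eqxx !scale1r.
  rewrite (linear_opZ lc) (linear_opD lc) dotBl !dotZl !dotDl !dotZl.
  rewrite f_orthonormal eq_sym (negPf i0) !mulr0 addr0 mulr0 subr0 => /eqP.
  by rewrite mulf_eq0 (negPf (Ci_neq0 R)) -mulr2n mulrn_eq0 /= => /eqP.
have P1 : P 1.
  move=> i lt_i1n; have lt_in : (i < n)%N by lia.
  have n0 : (0 < n)%N by lia.
  have := cx i 0 lt_in n0; rewrite entry xf0 (linear_opZ lc) dotZl.
  have -> : dot (c (f 0)) (x (f i)) = mu 0 * c00 * (i == 1)%:R.
    case: i lt_i1n {lt_in} => [|i] lt_i1n.
      by rewrite xf0 dotZr rmorphN /= P0 // !mulr0.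
    rewrite xfS dotBr !dotZr !mu_real !P0 ?eqSS ?mulr0 ?subr0; first last.
    - by lia.
    - by lia.
    by case: eqP => [->|_]; rewrite ?mulr0 // mulrA.
  rewrite mulNr -mulrA -[X in X + _]opprK -[X in _ + X]opprK -opprD => /eqP.
  rewrite oppr_eq0 opprK -mulrBr mulf_eq0 (negPf (mu0 0)) subr_eq0.
  by move/eqP.
have PS j : P j -> P j.+1 -> P j.+2.
  move=> Pj PSj i lt_n.
  have lt_in : (i < n)%N by lia.
  have lt_jn : (j.+1 < n)%N. by lia.
  have lt_n1 : (i + j.+1 < n)%N by lia.
  have lt_n2 : (i + j < n)%N by lia.
  have := cx i j.+1 lt_in lt_jn; rewrite entry xfS (linear_opB lc) dotBl.
  rewrite !(linear_opZ lc) !dotZl Pj //.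
  have -> : dot (c (f j.+1)) (x (f i)) =
      mu j.+1 * (c00 * (i == j.+2)%:R) - mu j * (c00 * (i == j)%:R).
    case: i lt_n lt_n1 {lt_in lt_n2} => [|i] lt_n lt_n1.
      rewrite xf0 dotZr rmorphN /= mu_real PSj ?eqSS; last by lia.
      by rewrite !mulr0 sub0r mulNr; case: eqP => [<-|]; rewrite ?mulr0.
    rewrite xfS dotBr !dotZr !mu_real !PSj ?eqSS; first last.
    - by lia.
    - by lia.
    congr (_ - _); last by case: eqP => [<-|_] //; rewrite !mulr0.
    by case: eqP => [->|_] //; rewrite !mulr0.
  rewrite addrC addrA subrK -mulrBr => /eqP.
  by rewrite mulf_eq0 (negPf (mu0 _)) subr_eq0 /= eq_sym => /eqP.
suff PP j : P j /\ P j.+1 by move=> j; case: (PP j).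
by elim: j => [|j [Pj PSj]]; split=> //; apply: PS.
Qed.

(** This is the 2-local condition seen at one point t of Omega, with [ev x] = x(t) and [del x] =
    Delta(x)(t). The abstract index type is kept because Delta(x)(t) might a priori depend on all of
    x and not only on x(t). *)
Definition two_local (X : Type) (L : set X) (ev del : X -> H -> H) : Prop :=
  forall x y, L x -> L y ->
    exists a, [/\ Bsk dot a, del x = comm a (ev x) & del y = comm a (ev y)].

(** * 2-local maps at a fixed point: finite corners, then the whole operator *)

Section TwoLocal.
Variables (X : Type) (L : set X) (ev : X -> H -> H).
Hypothesis ev_Bsk : forall x, L x -> Bsk dot (ev x).
Hypothesis ev_rank2 :
  forall u, fspan u -> exists x, L x /\ ev x = rank2 dot u u.
Hypothesis ev_diagonal : forall n, exists x, L x /\ ev x = regular_diagonal n.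

Lemma two_local_sub del a : two_local L ev del -> Bsk dot a ->
  two_local L ev (fun x => del x - comm a (ev x)).
Proof.
move=> loc Ba x y Lx Ly; have [b [Bb -> ->]] := loc x y Lx Ly.
exists (b - a); split; first exact: Bsk_sub.
- by rewrite comm_subl //; apply/BskL/ev_Bsk.
- by rewrite comm_subl //; apply/BskL/ev_Bsk.
Qed.

Lemma two_local_Bsk del x : two_local L ev del -> L x -> Bsk dot (del x).
Proof.
by move=> loc Lx; have [a [Ba -> _]] := loc x x Lx Lx; apply/Bsk_comm/ev_Bsk.
Qed.

Lemma two_local_form del u p x : two_local L ev del ->
  L p -> ev p = rank2 dot u u -> del p = 0 -> L x -> dot (del x u) u = 0.
Proof.
move=> loc Lp evp delp Lx; have [c [Bc -> cp]] := loc x p Lx Lp.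
move: cp; rewrite delp evp => /esym/(rank2_commutant Bc)[alpha cu].
exact: comm_eigen_form (ev_Bsk Lx) cu.
Qed.

(** After the subtraction, any c serving both [d] and i u u^*, with u = f_k + z f_l, has f_k and f_l
    as eigenvectors. The vanishing of the form at J then forces equal eigenvalues, so u is an
    eigenvector too and T kills i u u^*. *)
Lemma two_local_corner del n : two_local L ev del ->
  exists a, Bsk dot a /\ forall x i j, L x -> (i < n)%N -> (j < n)%N ->
    dot (del x (f j)) (f i) = dot (comm a (ev x) (f j)) (f i).
Proof.
move=> loc; have [d [Ld evd]] := ev_diagonal n.
pose J := \sum_(k < n) f k; have [pJ [LpJ evpJ]] := ev_rank2 (fspan_sum n).
have [a [Ba deld delpJ]] := loc d pJ Ld LpJ; exists a; split=> //.
pose T := fun x => del x - comm a (ev x).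
have locT : two_local L ev T := two_local_sub loc Ba.
have Td : T d = 0 by rewrite /T deld subrr.
have TpJ : T pJ = 0 by rewrite /T delpJ subrr.
have dotJ k : (k < n)%N -> dot (f k) J = 1.
  move=> lt_kn; rewrite dotC /J.
  under eq_bigr do rewrite -[f _]scale1r.
  by rewrite (coord_sum _ (fun=> 1)) lt_kn rmorph1.
(* The equation obtained from J has the factor conj z - z, so it says nothing for real z; z = 0 is
   kept for the diagonal entries. *)
have Tform z k l x : (k < n)%N -> (l < n)%N -> L x -> z = 0 \/ z^* != z ->
    dot (T x (f k + z *: f l)) (f k + z *: f l) = 0.
  move=> lt_kn lt_ln Lx zP; set u := _ + _.
  have [p [Lp evp]] : exists p, L p /\ ev p = rank2 dot u u.
    by apply/ev_rank2/fspan_add; [apply: fspan_f | apply: fspanZ].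
  apply: (two_local_form locT Lp evp) => //.
  have [c [Bc Tp]] := locT p d Lp Ld.
  rewrite Td evd evp in Tp *; move=> /esym cd; rewrite Tp.
  have [alpha ck] := regular_diagonal_commutant Bc cd lt_kn.
  have [beta cl] := regular_diagonal_commutant Bc cd lt_ln.
  have cu : c u = alpha *: f k + (z * beta) *: f l.
    by rewrite /u (linear_opD (BskL Bc)) (linear_opZ (BskL Bc)) ck cl scalerA.
  have [z0|z_neq] := zP.
    by apply: (comm_rank2_eigen (alpha := alpha)) => //;
      rewrite cu /u z0 mul0r !scale0r !addr0.
  suff alphaE : alpha = beta.
    by apply: (comm_rank2_eigen (alpha := alpha)) => //;
      rewrite cu /u -alphaE scalerDr scalerA mulrC.
  (* Since <f_k, J> = <f_l, J> = 1, the form <[c, p] J, J> works out to 2 i (conj z - z) (alpha -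
     beta). *)
  have := two_local_form locT LpJ evpJ TpJ Lp; rewrite Tp -/J commE dotBl /rank2.
  rewrite (linear_opZ (BskL Bc)) (linear_opD (BskL Bc)) (linear_opZ (BskL Bc)).
  rewrite !dotZl !dotDl !dotZl [dot (c J) u](Bsk_skew Bc) -mulrBr cu.
  rewrite /u !(dotDl, dotDr, dotZl, dotZr) !dotJ // ![dot J _]dotC !dotJ //.
  rewrite rmorph1 rmorphM /=.
  have [k0|] := eigen_imaginary Bc ck.
    by have := dotJ k lt_kn; rewrite k0 dot0l => /esym/eqP; rewrite oner_eq0.
  have [l0|] := eigen_imaginary Bc cl.
    by have := dotJ l lt_ln; rewrite l0 dot0l => /esym/eqP; rewrite oner_eq0.
  move=> -> -> /eqP; rewrite mulf_eq0 (negPf (Ci_neq0 R)) /= => /eqP eq0.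
  have : 2%:R * (z^* - z) * (alpha - beta) = 0 by rewrite -[RHS]eq0; ring.
  move/eqP; rewrite !mulf_eq0 pnatr_eq0 !subr_eq0 (negPf z_neq) /=.
  by move/eqP.
move=> x i j Lx lt_in lt_jn; apply/eqP; rewrite -subr_eq0 -dotBl.
rewrite -[_ - _]/(T x (f j)).
have lT : linear (T x) by apply/BskL/(two_local_Bsk locT).
apply/eqP/(polarization lT) => [||z z_neq].
- by have := Tform 0 i i x lt_in lt_in Lx (or_introl erefl); rewrite scale0r addr0.
- by have := Tform 0 j j x lt_jn lt_jn Lx (or_introl erefl); rewrite scale0r addr0.
- by apply: Tform => //; right.
Qed.

Lemma two_local_implemented mu o del :
  (forall i, mu i != 0) -> L o -> tridiagonal mu (ev o) ->
  two_local L ev del ->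
  exists a, Bsk dot a /\ forall x, L x -> del x = comm a (ev x).
Proof.
move=> mu0 Lo tri loc.
have [p0 [Lp0 evp0]] := ev_rank2 (fspan_f 0).
have [a [Ba delo delp0]] := loc o p0 Lo Lp0; exists a; split=> //.
pose T := fun x => del x - comm a (ev x).
have locT : two_local L ev T := two_local_sub loc Ba.
have T_Bsk := two_local_Bsk locT.
have To : T o = 0 by rewrite /T delo subrr.
have Tp0 : T p0 = 0 by rewrite /T delp0 subrr.
have Tform z k l x : L x -> dot (T x (f k + z *: f l)) (f k + z *: f l) = 0.
  move=> Lx; set u := _ + _.
  have [p [Lp evp]] : exists p, L p /\ ev p = rank2 dot u u.
    by apply/ev_rank2/fspan_add; [apply: fspan_f | apply: fspanZ].
  apply: (two_local_form locT Lp evp) => //.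
  have B0 : Bsk dot (0 : H -> H) by rewrite -To; apply: T_Bsk.
  apply: (Bsk_coord_inj) => // [|i j]; first exact: T_Bsk.
  (* The corner is large enough for the entries (i,k), (i,l), (k,j) and (l,j) of c to lie in the
     triangle where c is scalar. *)
  have [c [Bc Tc]] := two_local_corner (i + j + k + l).+1 locT.
  have lc := BskL Bc.
  have cE : forall j' i', (i' + j' < (i + j + k + l).+1)%N ->
      dot (c (f j')) (f i') = dot (c (f 0)) (f 0) * (i' == j')%:R.
    apply: (tridiagonal_commutant (ev_Bsk Lo) Bc mu0 tri).
    - by move=> i' j' lti ltj; rewrite -Tc // To dot0l.
    - by move=> i' j' lti ltj; rewrite -evp0 -Tc // Tp0 dot0l.
  move: (dot (c (f 0)) (f 0)) cE => c00 cE.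
  rewrite Tc //; [|by lia..].
  rewrite [RHS]dot0l evp commE dotBl /rank2 (linear_opZ lc) (linear_opD lc).
  rewrite (linear_opZ lc) !(dotZl, dotDl) -mulrBr.
  have -> : dot (c u) (f i) = c00 * dot u (f i).
    rewrite /u (linear_opD lc) (linear_opZ lc) !(dotDl, dotZl) !f_orthonormal.
    by rewrite !cE; [rewrite ![i == _]eq_sym; ring | lia..].
  have -> : dot (c (f j)) u = c00 * dot (f j) u.
    rewrite /u !(dotDr, dotZr) !f_orthonormal.
    by rewrite !cE; [rewrite ![_ == j]eq_sym; ring | lia..].
  have -> : dot u (f i) = dot (f k) (f i) + z * dot (f l) (f i) by rewrite dotDl dotZl.
  ring.
move=> x Lx; apply/eqP; rewrite -subr_eq0; apply/eqP.
rewrite -[LHS]/(T x).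
have B0 : Bsk dot (0 : H -> H) by rewrite -To; apply: T_Bsk.
apply: (Bsk_coord_inj) => // [|i j]; first exact: T_Bsk.
rewrite dot0l; apply/(polarization (BskL (T_Bsk _ Lx))) => [||z _].
- by have := Tform 0 i i x Lx; rewrite scale0r addr0.
- by have := Tform 0 j j x Lx; rewrite scale0r addr0.
- exact: Tform.
Qed.

End TwoLocal.

End OrthonormalBasis.

(** * From matrix units to an adapted orthonormal basis *)

Section MatrixUnits.
Variables (R : realType) (H : completeNormedModType R[i]).
Variable dot : {dot H for Num.conj}.
Hypothesis Hnorm : induces_norm dot.

Definition line_projection (g : H) : H -> H := fun v => dot v g *: g.

Lemma normalize (v : H) : v != 0 -> exists c, c != 0 /\ dot (c *: v) (c *: v) = 1.
Proof.
move=> v0; exists (`|v|^-1); have nv0 : `|v| != 0 by rewrite normr_eq0.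
split; first by rewrite invr_neq0.
by rewrite Hnorm normrZ normfV normr_id mulVf // expr1n.
Qed.

Lemma unit_neq0 (g : H) : dot g g = 1 -> g != 0.
Proof. by move=> g1; rewrite -(dnorm_eq0 dot) g1 oner_eq0. Qed.

Lemma line_projectionE (g : H) : dot g g = 1 -> line_projection g g = g.
Proof. by move=> g1; rewrite /line_projection g1 scale1r. Qed.

Lemma line_projectionP (g : H) : dot g g = 1 -> projection dot (line_projection g).
Proof.
move=> g1; have ng : `|g| = 1.
  by apply/eqP; rewrite -(eqrXn2 (_ : 0 < 2)%N) // -Hnorm g1 expr1n.
split; first split.
- move=> c u v; rewrite /line_projection dotDl dotZl scalerDl.
  by rewrite scalerA.
- exists 1 => v; rewrite rmorph1 mul1r /line_projection normrZ ng mulr1.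
  rewrite -(ler_pXn2r (_ : 0 < 2)%N) ?nnegrE // -Hnorm.
  (* Positivity here is Bessel's inequality |<v,g>|^2 <= |v|^2. *)
  have := dnorm_ge0 dot (v - dot v g *: g).
  rewrite !(dotBl, dotBr, dotZl, dotZr) g1 [dot g v]dotC mulr1 subrr subr0.
  by rewrite subr_ge0 mulrC -normCK.
- by apply/funext => v; rewrite /= /line_projection dotZl g1 mulr1.
- by move=> u v; rewrite /line_projection dotZl dotZr -dotC mulrC.
Qed.

(** A projection q below the line of g equals <q g, g> times the line projection, by
    self-adjointness; idempotence makes this scalar 0 or 1. *)
Lemma line_projection_minimal (g : H) :
  dot g g = 1 -> minimal_projection dot (line_projection g).
Proof.
move=> g1; split; first exact: line_projectionP.
- move=> /(congr1 (fun p => p g)); rewrite line_projectionE //.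
  by apply/eqP/unit_neq0.
move=> q [[lq _] qq adjq] pq.
have qE v : q v = dot (q g) g *: (dot v g *: g).
  have pq' w : q w = dot (q w) g *: g by rewrite -[LHS](congr1 (fun p => p w) pq).
  by rewrite [LHS]pq' adjq [q g in LHS]pq' dotZr -dotC -adjq scalerA.
have : q (q g) = q g by rewrite -[RHS](congr1 (fun p => p g) qq).
rewrite qE [q g in RHS]qE g1 scale1r scalerA => /eqP.
rewrite -subr_eq0 -scalerBl scaler_eq0 (negPf (unit_neq0 g1)) orbF.
rewrite -[X in _ - X]mulr1 -mulrBr mulf_eq0 => /orP[/eqP qg0|].
  by left; apply/funext => v; rewrite qE qg0 scale0r.
rewrite subr_eq0 => /eqP qg1; right; apply/funext => v.
by rewrite qE qg1 scale1r.
Qed.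

(** The projection onto the line of any nonzero p v is nonzero and lies below p, so minimality
    identifies it with p. *)
Lemma minimal_projection_line (p : H -> H) :
  minimal_projection dot p -> exists g, dot g g = 1 /\ p = line_projection g.
Proof.
move=> [[[lp _] pp _] p0 minp].
have ppE u : p (p u) = p u by rewrite -[RHS](congr1 (fun q => q u) pp).
have [v pv0] : exists v, p v != 0.
  apply: contra_notP p0 => /forallNP pv; apply/funext => v.
  by apply/eqP/negPn/negP/pv.
have [c [c0 g1]] := normalize pv0; exists (c *: p v); split=> //.
have [] // := minp _ (line_projectionP g1); last 1 first.
- move=> /(congr1 (fun q => q (c *: p v))); rewrite line_projectionE // => /eqP.
  by rewrite (negPf (unit_neq0 g1)).
apply/funext => w; rewrite /= /line_projection !(linear_opZ lp).
by rewrite ppE.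
Qed.

Variable e : nat -> nat -> H -> H.
Hypothesis Hmax : maximal_orthogonal_family dot (fun i => e i i).
Hypothesis Hunits : matrix_units dot e.

(** With g a unit vector spanning the range of e_00, take f_i = e_i0 g. Completeness comes from
    maximality: a unit vector h orthogonal to all f_i would add its line projection to the
    family. *)
Lemma matrix_units_basis : exists f : nat -> H,
  [/\ forall i j, dot (f i) (f j) = (i == j)%:R,
      forall v, (forall i, dot v (f i) = 0) -> v = 0 &
      forall i j v, e i j v = dot v (f j) *: f i].
Proof.
have [einj [emin eorth] emax] := Hmax; have [eBH eadj emul] := Hunits.
have emulE i j k l v : e i j (e k l v) = if j == k then e i l v else 0.
  by rewrite -[LHS]/((e i j \o e k l) v) emul; case: ifP.
have [g [g1 e00]] : exists g, dot g g = 1 /\ e 0 0 = line_projection g.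
  by apply/minimal_projection_line/emin; exists 0%N.
have eg : e 0 0 g = g by rewrite e00 line_projectionE.
pose f i := e i 0 g.
have fo i j : dot (f i) (f j) = (i == j)%:R.
  rewrite /f eadj emulE; case: eqP => _; first by rewrite eg g1.
  by rewrite dot0r.
have eE i j v : e i j v = dot v (f j) *: f i.
  have -> : e i j v = e i 0 (e 0 0 (e 0 j v)) by rewrite !emulE !eqxx.
  rewrite e00 /line_projection (linear_opZ (proj1 (eBH i 0))).
  by rewrite eadj.
exists f; split=> // v vf; apply/eqP/negPn/negP => v0.
have [c [c0 h1]] := normalize v0; set h := c *: v in h1.
have hf i : dot h (f i) = 0 by rewrite /h dotZl vf mulr0.
have fh i : dot (f i) h = 0 by rewrite dotC hf rmorph0.
(* Maximality makes the projection onto h one of the e_ii, which kills h: a contradiction. *)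
have [i _ ei] : range (fun i => e i i) (line_projection h).
  rewrite -(emax (range (fun i => e i i) `|` [set line_projection h])).
  - by right.
  - split=> [p [/emin//|->]|p q]; first exact: line_projection_minimal.
    move=> [[i _ <-]|->] [[j _ <-]|->] neq; last by [].
    + by apply: eorth.
    + apply/funext => w; rewrite /= /line_projection (linear_opZ (proj1 (eBH i i))).
      by rewrite eE hf scale0r scaler0.
    + by apply/funext => w; rewrite /= eE /line_projection dotZl fh mulr0 scale0r.
  - by move=> p ?; left.
have := unit_neq0 h1; rewrite -[h](line_projectionE h1) -ei eE hf scale0r.
by rewrite eqxx.
Qed.

End MatrixUnits.

(** * Elements of the Lie subalgebra, and the matrix of x_o *)

Section LieSubalgebra.
Variables (R : realType) (Omega : Type) (H : completeNormedModType R[i]).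
Variable dot : {dot H for Num.conj}.
Variable f : nat -> H.
Hypothesis f_orthonormal : forall i j, dot (f i) (f j) = (i == j)%:R.
Variable e : nat -> nat -> H -> H.
Hypothesis eE : forall i j v, e i j v = dot v (f j) *: f i.

Lemma comm_jacobi (a x y : H -> H) : linear a -> linear x -> linear y ->
  comm a (comm x y) = comm (comm a x) y + comm x (comm a y).
Proof.
move=> la lx ly; apply/funext => v; rewrite fctE !commE.
(* Pairing with an arbitrary w turns the vector identity into a scalar one, within reach of
   [ring]. *)
rewrite (linear_opB la) (linear_opB lx) (linear_opB ly); apply: (@dotP _ _ dot) => w.
by rewrite !(dotBl, dotDl); ring.
Qed.

Section Membership.
Variable L : set (Omega -> H -> H).
Hypothesis HL : lie_subalgebra dot L.
Hypothesis HLe : forall i, L ('i%C *: const_map (e i i)).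
Hypothesis HLs : forall i j, i <> j -> L (s_map e i j).

Lemma regular_diagonal_mem n : L (const_map (regular_diagonal dot f n)).
Proof.
have [_ L0 LD LZ _] := HL; elim: n => [|n IH].
  rewrite (_ : const_map _ = 0) //; apply/funext => t; apply/funext => w.
  by rewrite /const_map /regular_diagonal big_ord0.
rewrite (_ : const_map _ = const_map (regular_diagonal dot f n) +
  real_complex R n.+1%:R *: ('i%C *: const_map (e n n))).
  by apply: LD => //; apply: LZ.
apply/funext => t; apply/funext => w; rewrite !fctE /const_map.
rewrite /regular_diagonal big_ord_recr /=; congr (_ + _).
by rewrite eE !scalerA rmorph_nat [_%:R * _]mulrC.
Qed.

(** The Lie subalgebra is only real, so z is split as x + i y. For k <> l the operator is x i (e_kl
    + e_lk) + y (e_kl - e_lk), where i (e_kl + e_lk) = [i e_kk, s_kl]; for k = l it is 2 x i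
    e_kk. *)
Lemma rank2_unit_mem k l z : L (const_map (rank2 dot (f k) (z *: f l))).
Proof.
have [_ L0 LD LZ LB] := HL.
have [x [y ->]] : exists x y, z = real_complex R x + 'i%C * real_complex R y.
  by exists (complex.Re z), (complex.Im z); apply: complexE.
have conjR r : (real_complex R r)^* = real_complex R r.
  by apply/conj_Creal; rewrite complex_real.
have conjz : (real_complex R x + 'i%C * real_complex R y)^* =
    real_complex R x - 'i%C * real_complex R y.
  by rewrite rmorphD rmorphM /= !conjR conj_Ci mulNr.
have [<-|/eqP ne_kl] := eqVneq k l.
  rewrite (_ : const_map _ =
    real_complex R (x + x) *: ('i%C *: const_map (e k k))); first exact: LZ.
  apply/funext => t; apply/funext => w.
  rewrite -[RHS]/(real_complex R (x + x) *: ('i%C *: e k k w)) /const_map /rank2 eE.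
  apply: (@dotP _ _ dot) => h; rewrite !(dotZl, dotDl) dotZr conjz rmorphD; ring.
rewrite (_ : const_map _ =
  real_complex R x *: bracket ('i%C *: const_map (e k k)) (s_map e k l)
  + real_complex R y *: s_map e k l); last first.
  have le i j : linear (e i j).
    by move=> c u v; rewrite !eE dotDl dotZl scalerDl scalerA.
  have mulE i j i' j' w : e i j (e i' j' w) = (j == i')%:R *: e i j' w.
    by rewrite !eE dotZl f_orthonormal eq_sym scalerA mulrC.
  apply/funext => t; apply/funext => w.
  rewrite -[RHS]/(real_complex R x *: ('i%C *: e k k (e k l w - e l k w) -
    (e k l ('i%C *: e k k w) - e l k ('i%C *: e k k w))) +
    real_complex R y *: (e k l w - e l k w)) /const_map.
  rewrite (linear_opB (le _ _)) !(linear_opZ (le _ _)) !mulE.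
  move/eqP: ne_kl => ne_kl; rewrite eqxx [l == k]eq_sym (negPf ne_kl).
  rewrite /rank2 !eE dotZr.
  apply: (@dotP _ _ dot) => h; rewrite !(dotBl, dotDl, dotZl) conjz.
  have ii : 'i%C * 'i%C = -1 :> R[i] by rewrite -expr2 sqr_i.
  rewrite mulr0n mulr1n; ring: ii.
by apply: LD; apply: LZ; [apply: LB; [apply: HLe|apply: HLs]|apply: HLs].
Qed.

(** [rank2] is symmetric and biadditive, and a scalar on one argument moves to the other as its
    conjugate. Two inductions on the spans thus reduce to [rank2_unit_mem]. *)
Lemma rank2_mem u v : fspan f u -> fspan f v -> L (const_map (rank2 dot u v)).
Proof.
have [_ L0 LD LZ LB] := HL.
have rank2_add u1 u2 v' : const_map (rank2 dot (u1 + u2) v') =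
    const_map (rank2 dot u1 v') + const_map (rank2 dot u2 v').
  apply/funext => t; apply/funext => w; rewrite !fctE /const_map /rank2.
  by apply: (@dotP _ _ dot) => h; rewrite !(dotZl, dotDl, dotDr); ring.
have rank2C u' v' : rank2 dot u' v' = rank2 dot v' u'.
  by apply/funext => w; rewrite /rank2 addrC.
have rank2Z c u' v' : rank2 dot (c *: u') v' = rank2 dot u' (c^* *: v').
  apply/funext => w; rewrite /rank2 !dotZr !scalerA conjCK [dot w v' * _]mulrC.
  by rewrite [_^* * _]mulrC.
have rank20 v' : L (const_map (rank2 dot 0 v')).
  rewrite (_ : const_map _ = 0) //; apply/funext => t; apply/funext => w.
  by rewrite /const_map /rank2 dot0r scaler0 scale0r addr0 scaler0.
have mem_f k v' : fspan f v' -> L (const_map (rank2 dot (f k) v')).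
  elim=> [|c l w _ IH]; rewrite rank2C //.
  by rewrite rank2_add; apply: LD; rewrite rank2C //; apply: rank2_unit_mem.
have fspan_scale c v' : fspan f v' -> fspan f (c *: v').
  elim=> [|d l w _ IH]; first by rewrite scaler0; constructor.
  by rewrite scalerDr scalerA; constructor.
move=> su sv; elim: su => [|c k w _ IH] //.
by rewrite rank2_add; apply: LD => //; rewrite rank2Z; apply/mem_f/fspan_scale.
Qed.
End Membership.

(** Only the terms n = i and n = j contribute to the coefficient (i, j), so its partial sums are
    eventually constant, and limits are unique. *)
Lemma weak_sum_tridiagonal (lambda : nat -> R[i]) (x : H -> H) (t : Omega) :
  weak_sum dot (fun n => lambda n *: s_map e n n.+1 t) x ->
  tridiagonal dot f lambda x.
Proof.
move=> xsum i j; set l := RHS.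
have : (series (fun n => dot ((lambda n *: s_map e n n.+1 t) (f j)) (f i)
    : R[i]^o)) @ \oo --> (l : R[i]^o).
  apply: cvg_near_cst; near=> N.
  rewrite /series /= (eq_bigr (fun n => (if n == i then (j == i.+1)%:R * lambda i else 0)
     - (if n == j then (i == j.+1)%:R * lambda j else 0))); last first.
    move=> n _; rewrite !fctE /s_map /const_map !fctE !eE dotZl dotBl !dotZl.
    rewrite !f_orthonormal mulrBr; congr (_ - _).
      by case: (eqVneq n i) => [->|_]; rewrite ?mulr1 ?mulr0 // mulrC.
    rewrite [j == n]eq_sym [n.+1 == i]eq_sym.
    by case: (eqVneq n j) => [->|_]; rewrite ?mul1r ?mul0r ?mulr0 // mulrC.
  rewrite sumrB -!big_mkcond !big_nat1_eq /=.
  have -> : (i < N)%N by near: N; exact: nbhs_infty_gt.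
  have -> : (j < N)%N by near: N; exact: nbhs_infty_gt.
  rewrite /l; have [->|_] := eqVneq j i.+1.
    by rewrite ltn_eqF // mul1r mul0r subr0.
  by rewrite mul0r sub0r; case: eqP => _; rewrite ?mul1r ?mul0r ?oppr0.
move=> lsum; exact: (cvg_unique (@norm_hausdorff _ _) (xsum _ _) lsum).
Unshelve. all: by end_near.
Qed.
End LieSubalgebra.

(** * Assembly over the points of Omega *)

Theorem theorem4p5 (R : realType) (Omega : Type)
  (H : completeNormedModType R[i]) (dot : {dot H for Num.conj})
  (Hnorm : induces_norm dot)
  (Hsep : separable_space H)
  (Hinf : infinite_dimensional H)
  (e : nat -> nat -> H -> H)
  (Hmax : maximal_orthogonal_family dot (fun i => e i i))
  (Hunits : matrix_units dot e)
  (lambda : nat -> R[i])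
  (Hlambda0 : forall n, lambda n <> 0)
  (Hlambda : cvgn (series (fun n => lambda n * Num.conj (lambda n) : R[i]^o)))
  (xo : Omega -> H -> H)
  (Hxo : forall t, weak_sum dot (fun n => lambda n *: s_map e n n.+1 t) (xo t))
  (HxoF : F_Bsk dot xo)
  (L : set (Omega -> H -> H))
  (HL : lie_subalgebra dot L)
  (HLxo : L xo)
  (HLe : forall i, L ('i%C *: const_map (e i i)))
  (HLs : forall i j, i <> j -> L (s_map e i j))
  (Delta : (Omega -> H -> H) -> Omega -> H -> H)
  (HDelta : two_local_spatial_derivation (F_Bsk dot) L Delta) :
  spatial_derivation (F_Bsk dot) L Delta.
Proof.
have [[Delta_mem _] Delta_loc] := HDelta; have [LF _ LD LZ LB] := HL.
have [f [fo fc eE]] := matrix_units_basis Hnorm Hmax Hunits.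
have pointwise t : exists b, Bsk dot b /\ forall x, L x -> Delta x t = comm b (x t).
  apply: (@two_local_implemented _ _ dot f fo fc _ L (fun x => x t) _ _ _ lambda xo
    (fun x => Delta x t)) => //.
  - by move=> x Lx; apply: LF.
  - move=> u su; exists (const_map (rank2 dot u u)); split=> //.
    exact: (rank2_mem fo eE HL).
  - move=> n; exists (const_map (regular_diagonal dot f n)); split=> //.
    exact: (regular_diagonal_mem eE HL).
  - by move=> i; apply/eqP.
  - exact: weak_sum_tridiagonal (Hxo t).
  - move=> x y Lx Ly; have [b [Fb -> ->]] := Delta_loc x y Lx Ly.
    by exists (b t).
(* The implementing operators can be chosen independently at each t, since F(Omega, B_sk(H))
   contains all maps into B_sk(H). *)
have [a aP] := choice pointwise.
have lin x t : L x -> linear (x t) by move=> Lx; apply: (@BskL _ _ dot); apply: LF.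
have la t : linear (a t) by apply: (@BskL _ _ dot); case: (aP t).
have DeltaE x t : L x -> Delta x t = comm (a t) (x t) by case: (aP t) => _; apply.
split; last first.
  exists a; split; first by move=> t; case: (aP t).
  by move=> x Lx; apply/funext => t; apply: DeltaE.
(* The derivation laws follow pointwise from the commutator formula, the last one by the Jacobi
   identity. *)
split=> //.
- move=> x y Lx Ly; apply/funext => t; rewrite DeltaE; last exact: LD.
  rewrite -[RHS]/(Delta x t + Delta y t) !DeltaE //; apply/funext => v.
  rewrite -[RHS]/(comm (a t) (x t) v + comm (a t) (y t) v) !commE.
  by rewrite (linear_opD (la t)) opprD addrACA.
- move=> r x Lx; apply/funext => t; rewrite DeltaE; last exact: LZ.
  rewrite -[RHS]/(real_complex R r *: Delta x t) DeltaE //; apply/funext => v.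
  rewrite -[RHS]/(real_complex R r *: comm (a t) (x t) v) !commE.
  by rewrite (linear_opZ (la t)) scalerBr.
- move=> x y Lx Ly; apply/funext => t; rewrite DeltaE; last exact: LB.
  rewrite -[bracket x y t]/(comm (x t) (y t)) (comm_jacobi dot) //; try exact: lin.
  by rewrite -!DeltaE.
Qed.
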